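(* Let $\mathcal{A}$ be a finite set and let $X\subset\mathcal{A}^{\mathbb{Z}^d}$ be a shift-invariant topological Markov field with the pivot property. Then the dimension of $\mathcal{M}^\sigma_X$, the vector space of shift-invariant Markov cocycles on $X$, is finite.
   Context: $\mathbb{Z}^d$ is regarded as the vertex set of the graph in which $n,m$ are adjacent iff $\|n-m\|_1=1$. For $F\subset\mathbb{Z}^d$, $\partial F$ is the set of sites outside $F$ adjacent to some site of $F$. The shift action is $(\sigma_n x)_m=x_{m+n}$; $X$ is shift-invariant if $\sigma_n(X)=X$ for all $n$. A topological Markov field is a compact set $X\subset\mathcal{A}^{\mathbb{Z}^d}$ (product topology) such that for all finite $F\subset\mathbb{Z}^d$ and $x,y\in X$ with $x|_{\partial F}=y|_{\partial F}$, the point $z$ given by $z_v=x_v$ for $v\in F$ and $z_v=y_v$ for $v\notin F$ belongs to $X$. $\Delta_X$ is the set of pairs $(x,y)\in X\times X$ with $x_n=y_n$ for all but finitely many $n$. $X$ has the pivot property if for all $(x,y)\in\Delta_X$ with $x\ne y$ there is a finite sequence $x=x^{(1)},x^{(2)},\dots,x^{(k)}=y$ of points of $X$ such that, for each $i$, $x^{(i)}$ and $x^{(i+1)}$ differ at exactly one site. A $\Delta_X$-cocycle is a function $M:\Delta_X\to\mathbb{R}$ with $M(x,z)=M(x,y)+M(y,z)$ whenever $(x,y),(y,z)\in\Delta_X$. It is a Markov cocycle if, for every finite $F$ and all $(x,y)\in\Delta_X$ with $x|_{F^c}=y|_{F^c}$, the value $M(x,y)$ is determined by $x|_{F\cup\partial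 F}$ and $y|_{F\cup\partial F}$. It is shift-invariant if $M(\sigma_n x,\sigma_n y)=M(x,y)$ for all $n\in\mathbb{Z}^d$. *)

(* Defs.v *)
From HB Require Import structures.
From mathcomp Require Import all_boot all_order all_algebra.
From mathcomp Require Import all_classical all_reals all_analysis.

Set Implicit Arguments.
Unset Strict Implicit.
Unset Printing Implicit Defensive.

Import Order.TTheory GRing.Theory Num.Theory.

Local Open Scope classical_set_scope.
Local Open Scope ring_scope.

Notation site d := 'rV[int]_d.

(* A^(Z^d), with the product of the discrete topologies. *)
Notation config d A := {ptws (site d) -> discrete_topology A}.

Section Configurations.
Variables (d : nat) (A : finType).
Implicit Types (F : set (site d)) (x y : config d A) (X : set (config d A)).

Definition site_adjacent (n m : site d) : Prop :=
  \sum_(i < d) `|n ord0 i - m ord0 i| = 1 :> int.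

Definition boundary F : set (site d) :=
  [set m | ~ F m /\ exists2 n, F n & site_adjacent n m].

Definition agree_on F x y : Prop := forall n, F n -> x n = y n.

Definition sigma (n : site d) x : config d A := fun m => x (m + n).

Definition shift_invariant X : Prop := forall n, sigma n @` X = X.

(* [patch y F x] is [x] on [F] and [y] off [F]. *)
Definition topological_Markov_field X : Prop :=
  compact X /\
  forall F x y, finite_set F -> X x -> X y ->
    agree_on (boundary F) x y -> X (patch y F x).

Definition Delta X : set (config d A * config d A) :=
  [set p | [/\ X p.1, X p.2 & finite_set [set n | p.1 n <> p.2 n]]].

Definition pivot_property X : Prop :=
  forall x y, Delta X (x, y) -> x <> y ->
    exists (k : nat) (s : nat -> config d A),
      [/\ s 0%N = x, s k = y,
          forall i, (i <= k)%N -> X (s i) &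
          forall i, (i < k)%N -> exists! n, s i n <> s i.+1 n].

End Configurations.

Section Cocycles.
Variables (R : realType) (d : nat) (A : finType) (X : set (config d A)).

(* [R^o] is [R] as a vector space over itself, so that the functions from
   [Delta X] to [R] inherit the pointwise vector space structure. *)
Notation Delta_fun := (Delta X -> R^o).
Implicit Types (M : Delta_fun).

Definition at_pair M x y (xy : Delta X (x, y)) : R := M (SigSub (mem_set xy)).

Definition is_cocycle M : Prop :=
  forall x y z (xy : Delta X (x, y)) (yz : Delta X (y, z))
         (xz : Delta X (x, z)),
    at_pair M xz = at_pair M xy + at_pair M yz.

Definition is_Markov M : Prop :=
  forall F x y x' y' (xy : Delta X (x, y)) (xy' : Delta X (x', y')),
    finite_set F -> agree_on (~` F) x y -> agree_on (~` F) x' y' ->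
    agree_on (F `|` boundary F) x x' -> agree_on (F `|` boundary F) y y' ->
    at_pair M xy = at_pair M xy'.

(* When [X] is shift-invariant, [(sigma n x, sigma n y)] is always in
   [Delta X] if [(x, y)] is, so the hypothesis [sxy] is no restriction. *)
Definition is_shift_invariant M : Prop :=
  forall n x y (xy : Delta X (x, y)) (sxy : Delta X (sigma n x, sigma n y)),
    at_pair M sxy = at_pair M xy.

Definition si_Markov_cocycle : {pred Delta_fun} :=
  mem [set M | [/\ is_cocycle M, is_Markov M & is_shift_invariant M]].

Lemma si_Markov_cocycle_submod_closed : submod_closed si_Markov_cocycle.
Proof.
split.
  apply/mem_set; split.
  - by move=> x y z xy yz xz; rewrite /at_pair addr0.
  - by [].
  - by [].
move=> a M N /set_mem[cM mM sM] /set_mem[cN mN sN].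
have atE x y (xy : Delta X (x, y)) :
  at_pair (a *: M + N) xy = a * at_pair M xy + at_pair N xy by [].
apply/mem_set; split.
- move=> x y z xy yz xz.
  by rewrite !atE (cM _ _ _ xy yz) (cN _ _ _ xy yz) mulrDr addrACA.
- move=> F x y x' y' xy xy' Ffin Fxy Fxy' xx' yy'.
  rewrite !atE (mM F _ _ _ _ xy xy') //.
  by rewrite (mN F _ _ _ _ xy xy').
- by move=> n x y xy sxy; rewrite !atE (sM _ _ _ xy) (sN _ _ _ xy).
Qed.

HB.instance Definition _ :=
  GRing.isSubmodClosed.Build R Delta_fun si_Markov_cocycle
    si_Markov_cocycle_submod_closed.

Record siMarkovCocycle := SiMarkovCocycle {
  cocycle_fun : Delta_fun;
  _ : cocycle_fun \in si_Markov_cocycle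
}.

HB.instance Definition _ := [isSub for cocycle_fun].
HB.instance Definition _ := [Choice of siMarkovCocycle by <:].
HB.instance Definition _ := [SubChoice_isSubLmodule of siMarkovCocycle by <:].

End Cocycles.

(* [Vector.axiom n V] is the type of linear bijections [V -> 'rV[K]_n]. *)
Definition finite_dimensional (K : fieldType) (V : lmodType K) : Prop :=
  exists n : nat, inhabited (Vector.axiom n V).

(* Main.v *)
From HB Require Import structures.
Require Import Defs.
From mathcomp Require Import all_boot all_order all_algebra.
From mathcomp Require Import all_classical all_reals all_analysis.
From mathcomp Require Import zify.

(** A shift-invariant Markov cocycle [M] is determined by finitely many real
    numbers. By the pivot property any pair of [Delta X] is joined by a chain
    of single-site changes, so by additivity [M] is determined by its values on
    pairs that differ at one site. By shift-invariance that site may be taken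
    to be the origin, and by the Markov property applied to [F = {0}] the value
    then depends only on the two patterns seen on the origin and its
    neighbours. There are finitely many such pairs of patterns because the
    alphabet is finite. Choosing one representative pair of configurations for
    each pair of patterns and evaluating [M] on these is therefore a linear map
    to a coordinate space ([local_values]), and it is injective
    ([local_values_inj]). A vector space that embeds linearly in a coordinate
    space is finite-dimensional ([finite_dimensional_inj]). *)

Set Implicit Arguments.
Unset Strict Implicit.
Unset Printing Implicit Defensive.

Import Order.TTheory GRing.Theory Num.Theory.

Local Open Scope classical_set_scope.
Local Open Scope ring_scope.

(** Nothing provides a basis of [V] beforehand: among the families of [V] whose
    images are independent, which have at most [n] members, one of maximal size
    is a basis, and coordinates in it are read off through its image [B]. *)
Lemma finite_dimensional_inj (K : fieldType) (V : lmodType K) (n : nat)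
    (f : {linear V -> 'rV[K]_n}) : injective f -> finite_dimensional V.
Proof.
move=> f_inj.
pose image r (w : 'I_r -> V) := \matrix_(i < r) f (w i).
pose indep r := `[< exists w : 'I_r -> V, row_free (image r w) >].
have indep0 : exists r, indep r.
  exists 0%N; apply/asboolP; exists (fun=> 0).
  by rewrite -row_leq_rank.
have indep_le r : indep r -> (r <= n)%N.
  move=> /asboolP[w /eqP wfree].
  by rewrite -wfree rank_leq_col.
case: (ex_maxnP indep0 indep_le) => r /asboolP[w wfree] rmax.
set B := image r w in wfree.
have fB v : (f v <= B)%MS.
  apply/negP => /negP vB.
  suff /rmax : indep (r + 1)%N by rewrite addn1 ltnn.
  apply/asboolP.
  pose w' (i : 'I_(r + 1)) := if fintype.split i is inl j then w j else v.
  exists w'.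
  have -> : image _ w' = col_mx B (f v).
    apply/row_matrixP => i; rewrite rowK /w' -[in RHS](fintype.splitK i).
    case: (fintype.split i) => j /=; first by rewrite rowKu rowK.
    by rewrite rowKd row_id.
  rewrite -row_leq_rank -addsmxE addn1 -[X in (X < _)%N](eqP wfree).
  apply: rank_ltmx; rewrite ltmxE addsmxSl /=.
  by apply: contra vB; apply: submx_trans; rewrite addsmxSr.
pose comb (a : 'rV[K]_r) := \sum_i a 0 i *: w i.
have f_comb a : f (comb a) = a *m B.
  rewrite linear_sum mulmx_sum_row; apply: eq_bigr => i _.
  by rewrite linearZ /= rowK.
exists r; constructor; exists (fun v => f v *m pinvmx B).
  by move=> a u v; rewrite linearP mulmxDl scalemxAl.
exists comb => [v|a].
  by apply: f_inj; rewrite f_comb mulmxKpV.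
by rewrite f_comb mulmxKp.
Qed.

(** Indexing the cube [{-1, 0, 1}^d], which contains the origin and its
    neighbours, by row vectors over ['I_3] makes the patterns on it a
    [finType]. *)
Definition cube_site (d : nat) (w : 'rV['I_3]_d) : site d :=
  \row_i ((w ord0 i)%:Z - 1).

Lemma cube_siteP (d : nat) (m : site d) :
  ([set 0] `|` boundary [set 0]) m -> exists w, m = cube_site w.
Proof.
move=> m_near.
have m_le1 i : `|m ord0 i| <= 1.
  case: m_near => [->|[_ [_ -> adj]]]; first by rewrite mxE.
  rewrite -[leRHS]adj (bigD1 i) //= mxE sub0r normrN lerDl.
  exact: sumr_ge0.
exists (\row_i inord (absz (m ord0 i + 1))).
apply/rowP => i; rewrite !mxE inordK; last by have := m_le1 i; lia.
by rewrite -[m 0 i]/(m ord0 i); have := m_le1 i; lia.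
Qed.

Section LocalValues.
Variables (R : realType) (d : nat) (A : finType) (X : set (config d A)).
Implicit Types (x y : config d A) (M : siMarkovCocycle R X).

Notation pattern := {ffun 'rV['I_3]_d -> A}.

Definition pattern_at0 x : pattern := [ffun w => x (cube_site w)].

Lemma pattern_at0_eq x y : pattern_at0 x = pattern_at0 y ->
  agree_on ([set 0] `|` boundary [set 0]) x y.
Proof.
move=> xy _ /cube_siteP[w ->].
by move/ffunP: xy => /(_ w); rewrite !ffunE.
Qed.

Definition represents (p : pattern * pattern) (q : Delta X) : Prop :=
  [/\ agree_on (~` [set 0]) (val q).1 (val q).2,
      pattern_at0 (val q).1 = p.1 & pattern_at0 (val q).2 = p.2].

(** The representative is chosen from [p] alone, not from [M], which makes the
    value linear in [M]; it is [0] at pairs of patterns without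
    representatives. *)
Definition local_value M (p : pattern * pattern) : R :=
  if pselect (exists q, represents p q) is left ex_q
  then cocycle_fun M (projT1 (cid ex_q)) else 0.

Definition local_values M : 'rV[R]_#|{: pattern * pattern}| :=
  \row_i local_value M (enum_val i).

Lemma local_values_linear : linear local_values.
Proof.
move=> a M N; apply/rowP => i; rewrite !mxE /local_value.
by case: pselect => // _; rewrite mulr0 addr0.
Qed.

HB.instance Definition _ :=
  GRing.isLinear.Build R (siMarkovCocycle R X) _ *:%R local_values
    local_values_linear.

Lemma siMarkovCocycleP M :
  [/\ is_cocycle (cocycle_fun M), is_Markov (cocycle_fun M) &
      is_shift_invariant (cocycle_fun M)].
Proof. exact: set_mem (valP M). Qed.

Lemma at_pair_val (M : Delta X -> R^o) (q : Delta X)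
    (xy : Delta X ((val q).1, (val q).2)) : at_pair M xy = M q.
Proof. by congr M; apply: val_inj => /=; case: (val q). Qed.

Lemma Delta_val (q : Delta X) : Delta X ((val q).1, (val q).2).
Proof. by have := set_mem (valP q); case: (val q). Qed.

(** The representative chosen for the patterns of [(x, y)] need not be
    [(x, y)], but it has the same patterns, so the Markov property for
    [F = {0}] identifies the two values. *)
Lemma local_valueE M x y (xy : Delta X (x, y)) : agree_on (~` [set 0]) x y ->
  at_pair (cocycle_fun M) xy = local_value M (pattern_at0 x, pattern_at0 y).
Proof.
move=> xy0; rewrite /local_value; case: pselect => [ex_q|]; last first.
  by case; exists (SigSub (mem_set xy)).
case: (cid ex_q) => q [q0 qx qy] /=; rewrite -(at_pair_val _ (Delta_val q)).
have [_ MM _] := siMarkovCocycleP M.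
by apply: (MM [set 0]) => //; apply: pattern_at0_eq.
Qed.

Hypothesis Xshift : shift_invariant X.

Lemma Delta_sigma n x y : Delta X (x, y) -> Delta X (sigma n x, sigma n y).
Proof.
case=> /= Xx Xy xy_fin; split => /=.
- by rewrite -(Xshift n); exists x.
- by rewrite -(Xshift n); exists y.
have -> : [set m | sigma n x m <> sigma n y m] =
    (fun m => m - n) @` [set m | x m <> y m].
  apply/seteqP; split => [m xym|_ [m xym <-]] /=.
    by exists (m + n); rewrite ?addrK.
  by rewrite /sigma subrK.
exact: finite_image.
Qed.

(** Shifting the site [n] to the origin reduces to [local_valueE]. *)
Lemma single_site_eq0 M n x y (xy : Delta X (x, y)) :
  local_values M = 0 -> agree_on (~` [set n]) x y ->
  at_pair (cocycle_fun M) xy = 0.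
Proof.
move=> M0 xyn; have [_ _ MS] := siMarkovCocycleP M.
rewrite -(MS n _ _ xy (Delta_sigma n xy)) local_valueE => [|m m0].
  set p := (_, _); move/rowP: M0 => /(_ (enum_rank p)).
  by rewrite !mxE enum_rankK.
by apply: xyn => mn; apply: m0; apply: (addIr n); rewrite add0r.
Qed.

Hypothesis Xpivot : pivot_property X.

(** Additivity along a chain of single-site changes from [x] to [y]. *)
Lemma local_values_eq0 M x y (xy : Delta X (x, y)) :
  local_values M = 0 -> at_pair (cocycle_fun M) xy = 0.
Proof.
move=> M0; have [MC _ _] := siMarkovCocycleP M.
have diag0 z (zz : Delta X (z, z)) : at_pair (cocycle_fun M) zz = 0.
  by apply: (addrI (at_pair (cocycle_fun M) zz)); rewrite -MC addr0.
have [exy|xny] := pselect (x = y); first by case: _ / exy in xy *.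
have [k [s [s0 sk Xs s_pivot]]] := Xpivot xy xny.
have Delta_step i : (i < k)%N ->
    exists n, Delta X (s i, s i.+1) /\ agree_on (~` [set n]) (s i) (s i.+1).
  move=> ik; have [n [_ n_uniq]] := s_pivot i ik.
  exists n; split.
    split; [exact/Xs/ltnW|exact: Xs|].
    by apply: (@sub_finite_set _ _ [set n]) => // m /= /n_uniq.
  by move=> m mn; apply: contrapT => /n_uniq nm; exact: mn.
have chain i : (i <= k)%N ->
    exists xs : Delta X (x, s i), at_pair (cocycle_fun M) xs = 0.
  elim: i => [_|i IH ik].
    have xx : Delta X (x, x).
      case: xy => /= Xx _ _; split => //=.
      by apply: (@sub_finite_set _ _ set0).
    by rewrite s0; exists xx.
  have [xs xs0] := IH (ltnW ik).
  have [n [ss ssn]] := Delta_step i ik.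
  have xs' : Delta X (x, s i.+1).
    case: xs {xs0} ss => /= Xx _ fin1 [/= _ Xs' fin2]; split => //=.
    have fin12 : finite_set ([set m | x m <> s i m] `|`
                             [set m | s i m <> s i.+1 m]).
      by rewrite finite_setU.
    apply: sub_finite_set fin12 => m /= xm.
    by have [e|] := pselect (x m = s i m); [right; rewrite -e|left].
  by exists xs'; rewrite (MC _ _ _ xs ss) xs0 (single_site_eq0 ss M0 ssn) addr0.
have [] := chain k (leqnn k); rewrite sk => xy' <-.
by congr at_pair; exact: Prop_irrelevance.
Qed.

Lemma local_values_inj : injective local_values.
Proof.
move=> M N MN; apply/eqP; rewrite -subr_eq0; apply/eqP/val_inj/funext => q.
rewrite -(at_pair_val _ (Delta_val q)); apply: local_values_eq0.
by rewrite linearB /= MN subrr.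
Qed.

End LocalValues.

Theorem proposition3p5 (R : realType) (d : nat) (A : finType)
    (X : set (config d A))
    (Xshift : shift_invariant X)
    (XTMF : topological_Markov_field X)
    (Xpivot : pivot_property X) :
  finite_dimensional (siMarkovCocycle R X).
Proof.
exact: finite_dimensional_inj (@local_values_inj R d A X Xshift Xpivot).
Qed.
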